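(* Let $\alpha\le\beta\le 1$ be real numbers and $K(x,y)=x^\alpha y^\beta+x^\beta y^\alpha$ for $(x,y)\in(0,\infty)^2$. Let $\nu\in(-1,0]$ and $$b(z,x,y)=(\nu+2)z^\nu\mathbf 1_{(0,x)}(z)x^{-\nu-1}+(\nu+2)z^\nu\mathbf 1_{(0,y)}(z)y^{-\nu-1},\qquad (z,x,y)\in(0,\infty)^3.$$ Let $f^{in}\in X_0\cap X_1^+$ with $M_1(f^{in})>0$ and assume further that $f^{in}\in X_{m_0}$ for some $m_0>1$. If $\alpha<0$, then for no $T\in(0,\infty]$ does there exist a mass-conserving weak solution on $[0,T)$ to the collision-induced breakage equation with initial condition $f^{in}$.
   Context: Functions are measurable. For $m\in\mathbb R$, $X_m:=L^1((0,\infty),x^m dx)$ with norm $\|h\|_{X_m}=\int_0^\infty x^m|h(x)|\,dx$, $M_m(h):=\int_0^\infty x^m h(x)\,dx$, and $X_m^+$ is the cone of (a.e.) non-negative elements of $X_m$; $X_{0,w}$ is $X_0=L^1(0,\infty)$ with its weak topology. The collision-induced breakage equation with collision kernel $K$, daughter distribution function $b$ and initial condition $f^{in}$ is $\partial_t f=\mathcal Bf$, $f(0)=f^{in}$, with $$\mathcal B f(x)=\frac12\int_x^\infty\int_0^y b(x,y-z,z)K(y-z,z)f(y-z)f(z)\,dz\,dy-\int_0^\infty K(x,y)f(x)f(y)\,dy.$$ Weak solution: for $T\in(0,\infty]$, a weak solution on $[0,T)$ is a non-negative $f\in C([0,T),X_{0,w})\cap L^\infty((0,T),X_1^+)$ such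 that $(s,x,y)\mapsto K(x,y)f(s,x)f(s,y)\in L^1((0,t)\times(0,\infty)^2)$ and $$\int_0^\infty\phi(x)(f(t,x)-f^{in}(x))\,dx=\frac12\int_0^t\int_0^\infty\int_0^\infty\zeta_\phi(x,y)K(x,y)f(s,x)f(s,y)\,dy\,dx\,ds$$ for all $t\in(0,T)$ and $\phi\in L^\infty(0,\infty)$, where $\zeta_\phi(x,y):=\int_0^{x+y}\phi(z)b(z,x,y)\,dz-\phi(x)-\phi(y)$. It is mass-conserving on $[0,T)$ if moreover $M_1(f(t))=M_1(f^{in})$ for all $t\in[0,T)$. *)

(* Defs.v *)
From HB Require Import structures.
From mathcomp Require Import all_boot all_order all_algebra.
From mathcomp Require Import all_classical all_reals all_analysis.
Set Implicit Arguments.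
Unset Strict Implicit.
Unset Printing Implicit Defensive.
Import Order.TTheory GRing.Theory Num.Theory.
Import numFieldNormedType.Exports.
Local Open Scope classical_set_scope.
Local Open Scope ring_scope.

(* Elements of the spaces L^1 and L^oo over (0,oo) are given by representatives
   R -> R; only their restrictions to (0,oo), up to null sets, matter. *)

Section Spaces.
Context {R : realType}.
Notation mu := (@lebesgue_measure R).

Definition pos : set R := `]0, +oo[.

(* X_m = L^1((0,oo), x^m dx) *)
Definition X (m : R) (h : R -> R) : Prop :=
  mu.-integrable pos (fun x => (x `^ m * h x)%:E).

Definition Xnorm (m : R) (h : R -> R) : \bar R :=
  \int[mu]_(x in pos) (x `^ m * `|h x|)%:E.

Definition M (m : R) (h : R -> R) : \bar R :=
  \int[mu]_(x in pos) (x `^ m * h x)%:E.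

Definition ae_nonneg (h : R -> R) : Prop :=
  {ae mu, forall x, x \in pos -> 0 <= h x}.

(* the cone X_m^+ *)
Definition Xplus (m : R) (h : R -> R) : Prop := X m h /\ ae_nonneg h.

Definition Linfty (phi : R -> R) : Prop :=
  measurable_fun pos phi /\
  exists C : R, {ae mu, forall x, x \in pos -> `|phi x| <= C}.

(* Continuous linear functionals on X_0; boundedness forces l to depend only on
   the a.e. class of its argument. *)
Definition X0_dual (l : (R -> R) -> R) : Prop :=
  (forall (a : R) (h1 h2 : R -> R), X 0 h1 -> X 0 h2 ->
     l (fun x => a * h1 x + h2 x) = a * l h1 + l h2) /\
  exists C : R, forall h, X 0 h -> (`|l h|%:E <= C%:E * Xnorm 0 h)%E.

(* The time intervals [0,T) and (0,T), with T possibly +oo. *)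
Definition ico0 (T : \bar R) : set R := [set t | 0 <= t /\ (t%:E < T)%E].
Definition ioo0 (T : \bar R) : set R := [set t | 0 < t /\ (t%:E < T)%E].

(* f \in C([0,T), X_{0,w}): a map into a weak topology is continuous iff its
   composition with every continuous linear functional is. *)
Definition C_X0w (T : \bar R) (f : R -> R -> R) : Prop :=
  (forall t, ico0 T t -> X 0 (f t)) /\
  (forall l, X0_dual l -> {within ico0 T, continuous (fun t => l (f t))}).

(* X_m-valued simple functions of time *)
Definition X_simple (m : R) (s : R -> R -> R) : Prop :=
  exists (n : nat) (A : 'I_n -> set R) (h : 'I_n -> R -> R),
    (forall i, measurable (A i) /\ X m (h i)) /\
    s = fun t x => \sum_(i < n) \1_(A i) t * h i x.

(* Bochner (strong) measurability of f : (0,T) -> X_m *)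
Definition X_measurable (m : R) (T : \bar R) (f : R -> R -> R) : Prop :=
  exists s : nat -> R -> R -> R, (forall n, X_simple m (s n)) /\
    {ae mu, forall t, t \in ioo0 T ->
      (fun n => Xnorm m (fun x => s n t x - f t x)) @ \oo --> 0%E}.

(* f \in L^oo((0,T), X_m^+) *)
Definition Linfty_Xplus (m : R) (T : \bar R) (f : R -> R -> R) : Prop :=
  X_measurable m T f /\
  {ae mu, forall t, t \in ioo0 T -> Xplus m (f t)} /\
  exists C : R, {ae mu, forall t, t \in ioo0 T -> (Xnorm m (f t) <= C%:E)%E}.

End Spaces.

Section WeakSolution.
Context {R : realType}.
Notation mu := (@lebesgue_measure R).
Variables (K : R -> R -> R) (b : R -> R -> R -> R).

Definition zeta (phi : R -> R) (x y : R) : R :=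
  \int[mu]_(z in `]0, x + y[) (phi z * b z x y) - phi x - phi y.

Definition weak_solution (fin : R -> R) (T : \bar R) (f : R -> R -> R) : Prop :=
  [/\ forall t, ico0 T t -> ae_nonneg (f t),
      C_X0w T f,
      Linfty_Xplus 1 T f,
      forall t, ioo0 T t ->
        (mu \x (mu \x mu))%E.-integrable (`]0, t[ `*` (pos `*` pos))
          (fun p => (K p.2.1 p.2.2 * f p.1 p.2.1 * f p.1 p.2.2)%:E) &
      forall t phi, ico0 T t -> Linfty phi ->
        \int[mu]_(x in pos) (phi x * (f t x - fin x)) =
        2^-1 * \int[mu]_(s in `]0, t[) \int[mu]_(x in pos) \int[mu]_(y in pos)
                 (zeta phi x y * K x y * f s x * f s y)].

Definition mass_conserving_weak_solution
    (fin : R -> R) (T : \bar R) (f : R -> R -> R) : Prop :=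
  weak_solution fin T f /\ forall t, ico0 T t -> M 1 (f t) = M 1 fin.

End WeakSolution.

Section Coefficients.
Context {R : realType}.

Definition K_ab (alpha beta : R) (x y : R) : R :=
  x `^ alpha * y `^ beta + x `^ beta * y `^ alpha.

Definition b_nu (nu : R) (z x y : R) : R :=
  (nu + 2) * z `^ nu * \1_(`]0, x[ : set R) z * x `^ (- nu - 1) +
  (nu + 2) * z `^ nu * \1_(`]0, y[ : set R) z * y `^ (- nu - 1).

End Coefficients.

(* Main.v *)
Require Import Defs.
From HB Require Import structures.
From mathcomp Require Import all_boot all_order all_algebra.
From mathcomp Require Import all_classical all_reals all_analysis.
From mathcomp Require Import measurable_realfun ring lra.
Local Open Scope ring_scope.

Set Implicit Arguments.
Unset Strict Implicit.
Unset Printing Implicit Defensive.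
Import Order.TTheory GRing.Theory Num.Theory.
Import numFieldNormedType.Exports.
Local Open Scope classical_set_scope.

(** Since alpha < 0, small particles break at an unbounded rate, so that even the
    number of particles would have to become infinite at once; but a weak
    solution takes its values in X_0.

    Tested against the indicator of (0,e), the equation counts the particles of
    size less than e: writing N(t) for their number at time t, a collision of
    sizes x and y changes it by [excess x + excess y], where [excess x] is the
    mean number of fragments smaller than e produced by a particle of size x,
    minus one if x < e ([zeta_indic]). The excess is non-negative, it is at least
    1 for x < e (as nu <= 0), and of order (e/x)^(nu+1) for x >= e. Let P(t) be
    the integral of f(t) against a bounded positive weight lying below the powers
    of x that occur in the kernel. The two bounds on the excess yield two
    differential inequalities,

      N'(t) >= e^alpha P(t) N(t) / 2   and   N'(t) >= e^(nu+1) P(t)^2 / 2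

    ([rate_ge_indic], [rate_ge_weight], [collision_integral_ge]). Mass
    conservation at time 0 makes f(0) non-zero, hence P(0) > 0, and weak
    continuity keeps P >= delta > 0 on some interval [0,eta]. Cut [0,eta] into
    n+1 equal steps; the second inequality, used on the first step, provides a
    number of order e^(nu+1), which the first inequality multiplies by a constant
    times e^alpha on each of the n remaining steps ([iterated_growth]). Thus
    N(eta) >= C e^(n alpha + nu + 1) with C independent of e. For n large the
    exponent is at most -1, and the right-hand side tends to infinity as e tends
    to 0, whereas N(eta) never exceeds the finite norm of f(eta) in X_0.

    The analysis behind this is a form of Fubini's theorem: the right-hand side
    of the weak formulation is an iterated real-valued integral, in which a
    non-integrable section would silently count as 0. Integrability of
    K(x,y) f(s,x) f(s,y) over the product shows that this happens for a null set
    of times only ([integrable_section1], [integrable_iterated]). *)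

(** * Integrals of real functions *)

#[local] Instance ae_filter_lebesgue (R : realType) :
  Filter (nbhs (almost_everywhere (@lebesgue_measure R))).
Proof. exact: ae_filter_ringOfSetsType. Qed.

Section RealIntegrals.
Context d (T : measurableType d) (R : realType) (m : {measure set T -> \bar R}).

(** Reduces to the pointwise comparison of [f] with the maximum of [f] and [g],
    which has the same integral as [g]. *)
Lemma ae_le_Rintegral (D : set T) (f g : T -> R) : measurable D ->
  m.-integrable D (EFin \o f) -> m.-integrable D (EFin \o g) ->
  {ae m, forall x, D x -> f x <= g x} ->
  \int[m]_(x in D) f x <= \int[m]_(x in D) g x.
Proof.
move=> mD intf intg fg.
have intmax : m.-integrable D (EFin \o (fun x => Num.max (f x) (g x))).
  have /(le_integrable mD) : m.-integrable D
      ((fun x => `|(f x)%:E|) \+ (fun x => `|(g x)%:E|))%E.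
    by apply: integrableD => //; exact: integrable_abse.
  apply.
    apply/measurable_EFinP/measurable_maxr; apply/measurable_EFinP.
      exact: measurable_int intf.
    exact: measurable_int intg.
  move=> x _ /=; rewrite lee_fin [leRHS]ger0_norm ?addr_ge0//.
  by case: (leP (f x) (g x)) => _; rewrite ?lerDl ?lerDr.
have -> : \int[m]_(x in D) g x = \int[m]_(x in D) Num.max (f x) (g x).
  congr fine; apply: ae_eq_integral => //; [exact: measurable_int intg| |].
    exact: measurable_int intmax.
  by apply: filterS fg => x /= fg Dx; rewrite (max_idPr _)// fg.
by apply: le_Rintegral => // x Dx; rewrite le_max lexx.
Qed.

Lemma ae_Rintegral_ge0 (D : set T) (f : T -> R) : measurable D ->
  m.-integrable D (EFin \o f) -> {ae m, forall x, D x -> 0 <= f x} ->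
  0 <= \int[m]_(x in D) f x.
Proof.
move=> mD intf f0.
have I0 : \int[m]_(x in D) (cst 0 x : R) = 0 by rewrite /Rintegral integral0.
by rewrite -[leLHS]I0; apply: ae_le_Rintegral => //; exact: integrable0.
Qed.

Lemma integrable_fine (D : set T) (g : T -> \bar R) : measurable D ->
  m.-integrable D g -> m.-integrable D (EFin \o (fine \o g)).
Proof.
move=> mD intg; have mg := measurable_int _ intg.
apply: (le_integrable mD) intg => //.
  by apply/measurable_EFinP; exact: measurableT_comp mg.
by move=> x _ /=; case: (g x) => [r||]//=; rewrite ?normr0 leey.
Qed.

Lemma integral_fine (D : set T) (g : T -> \bar R) : measurable D ->
  m.-integrable D g ->
  (\int[m]_(x in D) (fine (g x))%:E = \int[m]_(x in D) g x)%E.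
Proof.
move=> mD intg; apply: ae_eq_integral => //.
- exact: measurable_int (integrable_fine mD intg).
- exact: measurable_int intg.
- by apply: filterS (integrable_ae mD intg) => x /= gx Dx; rewrite fineK// gx.
Qed.

Lemma integrable_bounded_mul (D : set T) (k h : T -> R) : measurable D ->
  measurable_fun D k -> (exists C : R, forall x, D x -> `|k x| <= C) ->
  m.-integrable D (EFin \o h) -> m.-integrable D (EFin \o (k \* h)).
Proof.
move=> mD mk [C kC] inth.
apply: (@le_integrable _ _ _ _ _ mD _ (fun x => C%:E * (h x)%:E)%E).
- apply/measurable_EFinP/measurable_funM => //.
  exact/measurable_EFinP/(measurable_int m).
- move=> x Dx /=; rewrite lee_fin !normrM ler_wpM2r//.
  by rewrite (le_trans (kC x Dx))// ler_norm.
- exact: integrableZl.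
Qed.

Lemma integrable_scale (D : set T) (a : R) (h : T -> R) : measurable D ->
  m.-integrable D (EFin \o h) -> m.-integrable D (EFin \o (fun x => a * h x)).
Proof.
move=> mD inth; apply: (@integrable_bounded_mul D (cst a)) => //.
by exists `|a|.
Qed.

End RealIntegrals.

(** * Fubini's theorem for real integrals over product sets *)

Section ProductDomain.
Context d1 d2 (T1 : measurableType d1) (T2 : measurableType d2) (R : realType).
Context (m1 : {sigma_finite_measure set T1 -> \bar R}).
Context (m2 : {sigma_finite_measure set T2 -> \bar R}).

Let patch_setX (D1 : set T1) (D2 : set T2) (f : T1 * T2 -> R) x y :
  ((EFin \o f) \_ (D1 `*` D2)) (x, y) =
  if x \in D1 then ((fun y => (f (x, y))%:E) \_ D2) y else 0%E.
Proof. by rewrite !patchE in_setX /=; case: (x \in D1). Qed.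

Lemma integrable_section1 (D1 : set T1) (D2 : set T2) (f : T1 * T2 -> R) :
  measurable D1 -> measurable D2 ->
  (m1 \x m2)%E.-integrable (D1 `*` D2) (EFin \o f) ->
  {ae m1, forall x, D1 x -> m2.-integrable D2 (fun y => (f (x, y))%:E)}.
Proof.
move=> mD1 mD2 /(integrable_mkcond _ (measurableX mD1 mD2)) /ae_integrable1.
apply: filterS => x intx D1x; apply/(integrable_mkcond _ mD2).
move: intx; congr (is_true (integrable _ _ _)); apply/funext => y.
by rewrite patch_setX mem_set.
Qed.

Let fubini_patch (D1 : set T1) (D2 : set T2) (f : T1 * T2 -> R) :
  fubini_F m2 ((EFin \o f) \_ (D1 `*` D2)) =
  (fun x => \int[m2]_(y in D2) (f (x, y))%:E)%E \_ D1.
Proof.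
apply/funext => x; rewrite /fubini_F.
under eq_integral do rewrite patch_setX.
rewrite [in RHS]patchE; case: ifPn => _; last by rewrite integral0.
by rewrite [RHS]integral_mkcond.
Qed.

Let integrable_partial (D1 : set T1) (D2 : set T2) (f : T1 * T2 -> R) :
  measurable D1 -> measurable D2 ->
  (m1 \x m2)%E.-integrable (D1 `*` D2) (EFin \o f) ->
  m1.-integrable D1 (fun x => \int[m2]_(y in D2) (f (x, y))%:E)%E.
Proof.
move=> mD1 mD2 /(integrable_mkcond _ (measurableX mD1 mD2)).
move=> /integrable_fubini_F; rewrite fubini_patch => intF.
exact/(integrable_mkcond _ mD1).
Qed.

Lemma integrable_Rintegral1 (D1 : set T1) (D2 : set T2) (f : T1 * T2 -> R) :
  measurable D1 -> measurable D2 ->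
  (m1 \x m2)%E.-integrable (D1 `*` D2) (EFin \o f) ->
  m1.-integrable D1 (fun x => (\int[m2]_(y in D2) f (x, y))%:E).
Proof.
by move=> mD1 mD2 intf; apply: integrable_fine => //; exact: integrable_partial.
Qed.

Lemma Rintegral_setX (D1 : set T1) (D2 : set T2) (f : T1 * T2 -> R) :
  measurable D1 -> measurable D2 ->
  (m1 \x m2)%E.-integrable (D1 `*` D2) (EFin \o f) ->
  \int[m1]_(x in D1) \int[m2]_(y in D2) f (x, y) =
  \int[(m1 \x m2)%E]_(z in D1 `*` D2) f z.
Proof.
move=> mD1 mD2 intf; rewrite /Rintegral; congr fine.
rewrite integral_fine//; last exact: integrable_partial.
move/(integrable_mkcond _ (measurableX mD1 mD2)) : intf => intf.
rewrite [RHS]integral_mkcond -integral12_prod_meas1//.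
by rewrite fubini_patch [LHS]integral_mkcond.
Qed.

(** Holds for every measurable function, since [fine] is measurable: a
    non-integrable section contributes the value 0. *)
Lemma measurable_Rintegral (g : T1 * T2 -> R) : measurable_fun setT g ->
  measurable_fun setT (fun x => \int[m2]_y g (x, y)).
Proof.
move=> mg; apply: (@measurableT_comp _ _ _ _ _ _ fine) => //.
have mEg : measurable_fun setT (EFin \o g) by exact/measurable_EFinP.
rewrite (_ : (fun x => _) = (fubini_F m2 (EFin \o g)^\+ \-
  fubini_F m2 (EFin \o g)^\-)%E); last first.
  apply/funext => x; rewrite integralE.
  by congr (_ - _)%E; apply: eq_integral => y _; rewrite unlock.
apply: emeasurable_funB; apply: measurable_fun_fubini_tonelli_F => //.
  exact: measurable_funepos.
exact: measurable_funeneg.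
Qed.

End ProductDomain.

Section SigmaFiniteProduct.
Context d1 d2 (T1 : measurableType d1) (T2 : measurableType d2) (R : realType).
Context (m1 : {sigma_finite_measure set T1 -> \bar R}).
Context (m2 : {sigma_finite_measure set T2 -> \bar R}).

(** The product measure under a name that carries its sigma-finiteness, so that
    Fubini's theorem can be applied to a product of three factors. *)
Definition product_sf : set (T1 * T2)%type -> \bar R := (m1 \x m2)%E.

HB.instance Definition _ := Measure.copy product_sf (m1 \x m2)%E.

Lemma product_sf_sigma_finite : sigma_finite setT product_sf.
Proof.
have /sigma_finiteP[A [UA ndA Afin]] := sigma_finiteT m1.
have /sigma_finiteP[B [UB ndB Bfin]] := sigma_finiteT m2.
exists (fun n => A n `*` B n).
  apply/seteqP; split=> // -[x y] _.
  have [[i _ Aix] [j _ Bjy]] : (\bigcup_i A i) x /\ (\bigcup_i B i) y.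
    by rewrite -UA -UB.
  exists (maxn i j) => //; split => /=.
    by move: Aix; apply/subsetPset/ndA/leq_maxl.
  by move: Bjy; apply/subsetPset/ndB/leq_maxr.
move=> n; have [mA Aoo] := Afin n; have [mB Boo] := Bfin n.
split; first exact: measurableX.
by rewrite /product_sf product_measure1E// lte_mul_pinfty// ge0_fin_numE.
Qed.

HB.instance Definition _ :=
  Measure_isSigmaFinite.Build _ _ _ product_sf product_sf_sigma_finite.

End SigmaFiniteProduct.

Section TripleProduct.
Context d1 d2 d3 (T1 : measurableType d1) (T2 : measurableType d2)
  (T3 : measurableType d3) (R : realType).
Context (m1 : {sigma_finite_measure set T1 -> \bar R}).
Context (m2 : {sigma_finite_measure set T2 -> \bar R}).
Context (m3 : {sigma_finite_measure set T3 -> \bar R}).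

(** Almost everywhere the iterated integral is the integral over the product,
    which is integrable in the first variable; since a null set can hold
    non-measurable subsets, its measurability is proved separately, by moving the
    bracketing of the product from T1 * (T2 * T3) to (T1 * T2) * T3. *)
Lemma integrable_iterated (D1 : set T1) (D2 : set T2) (D3 : set T3)
    (f : T1 * (T2 * T3) -> R) :
  measurable D1 -> measurable D2 -> measurable D3 ->
  (m1 \x (m2 \x m3))%E.-integrable (D1 `*` (D2 `*` D3)) (EFin \o f) ->
  m1.-integrable D1
    (fun s => (\int[m2]_(x in D2) \int[m3]_(y in D3) f (s, (x, y)))%:E).
Proof.
move=> mD1 mD2 mD3 intf.
have mD23 : measurable (D2 `*` D3) by exact: measurableX.
have mf : measurable_fun setT (f \_ (D1 `*` (D2 `*` D3))).
  apply/(measurable_restrictT _ (measurableX mD1 mD23)).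
  by apply/measurable_EFinP; exact: measurable_int intf.
pose g (p : (T1 * T2) * T3) :=
  (f \_ (D1 `*` (D2 `*` D3))) (p.1.1, (p.1.2, p.2)).
have mg : measurable_fun setT g.
  apply: (measurableT_comp mf); apply: measurable_fun_pair => /=.
    exact: measurableT_comp.
  by apply: measurable_fun_pair => //; exact: measurableT_comp.
have mG := measurable_Rintegral m2 (measurable_Rintegral m3 mg).
have GE s : D1 s ->
    \int[m2]_x \int[m3]_y g ((s, x), y) =
    \int[m2]_(x in D2) \int[m3]_(y in D3) f (s, (x, y)).
  move=> D1s; rewrite [RHS]Rintegral_mkcond; congr Rintegral.
  apply/funext => x; rewrite patchE.
  have -> : (fun y => g (s, x, y)) =
      if x \in D2 then (fun y => f (s, (x, y))) \_ D3 else cst 0.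
    apply/funext => y; rewrite /g /= patchE !in_setX /= mem_set//=.
    case: ifPn => [/andP[-> y3]|]; first by rewrite patchE y3.
    by case: (x \in D2) => //= /negbTE y3; rewrite patchE y3.
  case: ifPn => _; first by rewrite -Rintegral_mkcond.
  by rewrite /Rintegral integral0.
have ae_eqE : {ae m1, forall s, D1 s ->
    \int[(m2 \x m3)%E]_(z in D2 `*` D3) f (s, z) =
    \int[m2]_x \int[m3]_y g ((s, x), y)}.
  have := @integrable_section1 _ _ _ _ _ m1 (product_sf m2 m3) _ _ f
    mD1 mD23 intf.
  apply: filterS => s ints D1s; rewrite GE// -Rintegral_setX//; exact: ints.
have intI := @integrable_Rintegral1 _ _ _ _ _ m1 (product_sf m2 m3) _ _ f
  mD1 mD23 intf.
have mGE : measurable_fun D1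
    (fun s => (\int[m2]_x \int[m3]_y g ((s, x), y))%:E).
  by apply/measurable_EFinP; apply: measurable_funS mG.
apply: (eq_integrable mD1 (fun s => (\int[m2]_x \int[m3]_y g ((s, x), y))%:E)).
  by move=> s; rewrite inE => D1s; rewrite GE.
apply/integrableP; split => //.
case/integrableP : intI => mI; congr (_ < _)%E.
apply: ae_eq_integral => //; [exact: measurableT_comp|exact: measurableT_comp|].
by apply: filterS ae_eqE => s /= sE D1s; rewrite sE.
Qed.

End TripleProduct.


(** * Fragments smaller than a given size *)

Section PowerDaughter.
Context (R : realType).
Notation mu := (@lebesgue_measure R).

Lemma integral_powR_segment (a c nu : R) : -1 < nu -> 0 < a -> a < c ->
  (\int[mu]_(z in `[a, c]) (z `^ nu)%:E =
   (c `^ (nu + 1) / (nu + 1) - a `^ (nu + 1) / (nu + 1))%:E)%E.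
Proof.
move=> nu1 a0 ac.
have n0 : nu + 1 != 0 by rewrite gt_eqF// -ltrBlDr sub0r.
pose F (x : R) := x `^ (nu + 1) / (nu + 1).
have dF (x : R) : 0 < x -> is_derive x 1 F (x `^ nu).
  move=> x0; have -> : F = (nu + 1)^-1 \*: (fun y : R => y `^ (nu + 1)).
    by apply/funext => y; rewrite /F mulrC.
  have dp := @is_derive1_powR R (nu + 1) x x0.
  by apply: is_derive_eq; rewrite addrK /GRing.scale /= mulKf.
rewrite EFinB; apply: (@continuous_FTC2 _ _ F a c ac).
- apply: derivable_within_continuous => x; rewrite in_itv/= => /andP[ax _].
  by apply: derivable_powR; rewrite in_itv/= (lt_le_trans a0).
- have cF (x : R) : 0 < x -> F y @[y --> x] --> F x.
    move=> x0; apply/differentiable_continuous/derivable1_diffP.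
    by case: (dF x x0).
  split => /=.
  + move=> x; rewrite in_itv/= => /andP[ax _].
    by case: (dF x (lt_trans a0 ax)).
  + exact/cvg_at_right_filter/cF.
  + exact/cvg_at_left_filter/cF/(lt_trans a0 ac).
- move=> x; rewrite in_itv/= => /andP[ax _].
  by rewrite derive1E; case: (dF x (lt_trans a0 ax)).
Qed.

(** For nu < 0 the integrand is unbounded at 0, so the fundamental theorem of
    calculus is used on the segments [c/(n+2), c], which exhaust (0, c]. *)
Lemma integral_powR0 (c nu : R) : -1 < nu -> 0 < c ->
  (\int[mu]_(z in `]0%R, c[) (z `^ nu)%:E = (c `^ (nu + 1) / (nu + 1))%:E)%E.
Proof.
move=> nu1 c0.
have mp (D : set R) : measurable_fun D (fun z : R => (z `^ nu)%:E).
  apply/measurable_EFinP; apply: measurable_funS (measurable_powR nu) => //.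
have n0 : 0 < nu + 1 by rewrite -ltrBlDr sub0r.
rewrite integral_itv_bndo_bndc//.
pose a n : R := c * n.+2%:R^-1.
have a0 n : 0 < a n by rewrite mulr_gt0 ?invr_gt0.
have ac n : a n < c by rewrite gtr_pMr// invf_lt1 ?ltr1n.
have -> : `]0%R, c]%classic = \bigcup_n `[a n, c]%classic.
  apply/seteqP; split=> x /=.
    rewrite in_itv/= => /andP[x0 xc].
    exists (Num.truncn (c / x)) => //=; rewrite in_itv/= xc andbT /a.
    rewrite ler_pdivrMr// mulrC -ler_pdivrMr//.
    by apply: ltW; apply: lt_trans (truncnS_gt _) _; rewrite ltr_nat.
  move=> [n _ /=]; rewrite !in_itv/= => /andP[ax ->].
  by rewrite (lt_le_trans (a0 n)).
have ndF : nondecreasing_seq (fun n => `[a n, c]%classic).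
  move=> n m nm; rewrite subsetEset; apply: subset_itvr.
  by rewrite bnd_simp ler_pM2l// lef_pV2 ?posrE// ler_nat.
have cv := @ge0_nondecreasing_set_cvg_integral _ _ _ _ _ mu ndF
  (fun n => measurable_itv _) (fun n => mp _)
  (fun n x _ => powR_ge0 x nu : (0 <= (x `^ nu)%:E)%E).
apply: (cvg_unique _ cv) => //.
have -> : (fun n => \int[mu]_(z in `[a n, c]) (z `^ nu)%:E)%E = (fun n =>
    (c `^ (nu + 1) / (nu + 1) - a n `^ (nu + 1) / (nu + 1))%:E).
  by apply/funext => n; apply: integral_powR_segment.
apply: cvg_EFin; first exact: nearW.
rewrite -[X in _ --> X]subr0 -(mul0r (nu + 1)^-1).
apply: cvgB; first exact: cvg_cst.
apply: cvgMl.
have /cvg_at_rightP := powR_cvg0 n0; apply; split => //.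
rewrite -(mulr0 c); apply: cvgMr.
by have := @cvg_harmonic R; rewrite -cvg_shiftS.
Qed.
End PowerDaughter.

Section SmallParticles.
Context (R : realType).
Notation mu := (@lebesgue_measure R).

Lemma integrable_powR_indic (c d nu : R) : -1 < nu -> 0 < c -> c <= d ->
  mu.-integrable `]0, d[ (EFin \o (fun z => z `^ nu * \1_(`]0, c[ : set R) z)).
Proof.
move=> nu1 c0 cd.
have -> : (EFin \o (fun z => z `^ nu * \1_(`]0, c[ : set R) z)) =
    (EFin \o (fun z : R => z `^ nu)) \_ `]0, c[.
  apply/funext => z; rewrite patchE /= indicE.
  by case: (z \in _); rewrite ?mulr1// mulr0.
apply/integrable_restrict => //.
rewrite setIidr; last by apply: subset_itvl; rewrite bnd_simp.
apply/integrableP; split.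
  by apply/measurable_EFinP; apply: measurable_funS (measurable_powR nu).
under eq_integral do rewrite /= ger0_norm ?powR_ge0//.
by rewrite integral_powR0// ltry.
Qed.

Lemma Rintegral_powR_indic (c d nu : R) : -1 < nu -> 0 < c -> c <= d ->
  \int[mu]_(z in `]0, d[) (z `^ nu * \1_(`]0, c[ : set R) z) =
  c `^ (nu + 1) / (nu + 1).
Proof.
move=> nu1 c0 cd.
have -> : (fun z => z `^ nu * \1_(`]0, c[ : set R) z) =
    (fun z : R => z `^ nu) \_ `]0, c[.
  apply/funext => z; rewrite patchE /= indicE.
  by case: (z \in _); rewrite ?mulr1// mulr0.
rewrite -Rintegral_mkcondr setIidr; last first.
  by apply: subset_itvl; rewrite bnd_simp.
by rewrite /Rintegral integral_powR0.
Qed.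

(** Net number of particles of size less than [e] gained when a particle of size
    [x] breaks: the fragments smaller than [e], minus the particle itself if it
    was smaller than [e]. *)
Definition excess (nu e x : R) : R :=
  (nu + 2) / (nu + 1) * (x `^ (- nu - 1) * Num.min x e `^ (nu + 1)) -
  \1_(`]0, e[ : set R) x.

(** The daughter distribution is a sum of one term for each of the two colliding
    particles, each supported below the size of its particle; hence the change
    splits, and the upper bound x + y of the integral is never reached. *)
Lemma zeta_indic (nu e x y : R) : -1 < nu -> 0 < e -> 0 < x -> 0 < y ->
  zeta (b_nu nu) (\1_(`]0, e[ : set R)) x y = excess nu e x + excess nu e y.
Proof.
move=> nu1 e0 x0 y0.
have m0 (w : R) : 0 < w -> 0 < Num.min w e by move=> w0; rewrite lt_min w0.
have mxy w : w = x \/ w = y -> Num.min w e <= x + y.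
  by move=> [->|->]; rewrite ge_min ?lerDl ?lerDr ltW.
pose p (w z : R) := (nu + 2) * w `^ (- nu - 1) *
  (z `^ nu * \1_(`]0, Num.min w e[ : set R) z).
have pE (w z : R) : \1_(`]0, e[ : set R) z * ((nu + 2) * z `^ nu *
    \1_(`]0, w[ : set R) z * w `^ (- nu - 1)) = p w z.
  rewrite /p !indicE !mem_setE !in_itv/= lt_min.
  by case: (0 < z); case: (z < w); case: (z < e); rewrite /=; ring.
have intp w : 0 < w -> w = x \/ w = y ->
    mu.-integrable `]0, (x + y)[ (EFin \o p w).
  move=> w0 wxy; apply: integrable_scale => //.
  by apply: integrable_powR_indic => //; [exact: m0|exact: mxy].
have Ip w : 0 < w -> w = x \/ w = y -> \int[mu]_(z in `]0, (x + y)[) p w z =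
    (nu + 2) / (nu + 1) * (w `^ (- nu - 1) * Num.min w e `^ (nu + 1)).
  move=> w0 wxy; rewrite RintegralZl//; last first.
    by apply: integrable_powR_indic => //; [exact: m0|exact: mxy].
  by rewrite Rintegral_powR_indic//; [ring|exact: m0|exact: mxy].
rewrite /zeta.
under eq_Rintegral do rewrite /b_nu mulrDr !pE.
rewrite RintegralD//; [|by apply: intp => //; left|by apply: intp => //; right].
rewrite (Ip x)//; last by left.
rewrite (Ip y)//; last by right.
by rewrite /excess; ring.
Qed.

Lemma measurable_excess (nu e : R) : measurable_fun setT (excess nu e).
Proof.
rewrite /excess; apply: measurable_funB; last exact: measurable_indic.
apply: measurable_funM => //; apply: measurable_funM.
  exact: measurable_powR.
apply: (measurableT_comp (measurable_powR (nu + 1))).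
exact: measurable_minr.
Qed.

Lemma excess_lt (nu e x : R) : -1 < nu -> 0 < x -> x < e ->
  excess nu e x = (nu + 1)^-1.
Proof.
move=> nu1 x0 xe; rewrite /excess (min_idPl (ltW xe)) -powRD; last first.
  by rewrite (gt_eqF x0) implybT.
rewrite (_ : - nu - 1 + (nu + 1) = 0); last by ring.
rewrite powRr0 indicE mem_set; last by rewrite /= in_itv/= x0.
by rewrite mulr1n; field; rewrite gt_eqF// -ltrBlDr sub0r.
Qed.

Lemma excess_ge (nu e x : R) : 0 < e -> e <= x ->
  excess nu e x = (nu + 2) / (nu + 1) * (x `^ (- nu - 1) * e `^ (nu + 1)).
Proof.
move=> e0 ex; rewrite /excess (min_idPr ex) indicE memNset ?subr0//.
by rewrite /= in_itv/= => /andP[_]; rewrite ltNge ex.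
Qed.

Lemma excess_ge0 (nu e x : R) : -1 < nu -> 0 < e -> 0 < x -> 0 <= excess nu e x.
Proof.
move=> nu1 e0 x0; have n1 : 0 < nu + 1 by rewrite -ltrBlDr sub0r.
have [xe|ex] := ltP x e; first by rewrite excess_lt// invr_ge0 ltW.
by rewrite excess_ge// mulr_ge0 ?mulr_ge0 ?powR_ge0 ?invr_ge0//; lra.
Qed.

Lemma excess_le (nu e x : R) : -1 < nu -> 0 < e -> 0 < x ->
  excess nu e x <= (nu + 2) / (nu + 1).
Proof.
move=> nu1 e0 x0; have n1 : 0 < nu + 1 by rewrite -ltrBlDr sub0r.
have k0 : 0 <= (nu + 2) / (nu + 1) by rewrite divr_ge0//; lra.
rewrite lerBlDr; apply: (@le_trans _ _ ((nu + 2) / (nu + 1))); last first.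
  by rewrite lerDl indicE ler0n.
rewrite ler_piMr// (_ : - nu - 1 = - (nu + 1)); last by ring.
rewrite powRN ler_pdivrMl ?powR_gt0// mulr1.
by rewrite ge0_ler_powR ?nnegrE ?ge_min ?lexx// ?le_min ?ltW.
Qed.

(** Particles below the size [e] multiply: each breakage adds 1/(nu+1) >= 1 to
    their number. *)
Lemma excess_ge_indic (nu e x : R) : -1 < nu -> nu <= 0 -> 0 < e -> 0 < x ->
  \1_(`]0, e[ : set R) x <= excess nu e x.
Proof.
move=> nu1 nu0 e0 x0; have [xe|ex] := ltP x e.
  rewrite excess_lt//; apply: (@le_trans _ _ 1).
    by rewrite indicE lern1 leq_b1.
  by rewrite invf_ge1; lra.
by rewrite indicE memNset ?excess_ge0//= in_itv/= x0/= ltNge ex.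
Qed.

(** Particles of every size feed those below [e], at a rate e^(nu+1) times a
    profile independent of [e]; cutting the profile off at 1 makes the bound hold
    for x < e as well. *)
Lemma excess_ge_power (nu e x : R) : -1 < nu -> nu <= 0 ->
    0 < e -> e <= 1 -> 0 < x ->
  e `^ (nu + 1) * Num.min 1 (x `^ (- nu - 1)) <= excess nu e x.
Proof.
move=> nu1 nu0 e0 e1 x0; have n1 : 0 < nu + 1 by rewrite -ltrBlDr sub0r.
have [xe|ex] := ltP x e.
  rewrite excess_lt//; apply: (@le_trans _ _ 1); last by rewrite invf_ge1; lra.
  rewrite -[leRHS]mulr1 ler_pM ?powR_ge0// ?le_min ?powR_ge0 ?ler01//.
    apply: (@le_trans _ _ (1 `^ (nu + 1))); last by rewrite powR1.
    by rewrite ge0_ler_powR ?nnegrE// ltW.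
rewrite excess_ge//; apply: (@le_trans _ _ (x `^ (- nu - 1) * e `^ (nu + 1))).
  by rewrite mulrC ler_wpM2r ?powR_ge0// ge_min lexx orbT.
rewrite ler_peMl// ?mulr_ge0 ?powR_ge0//.
by rewrite ler_pdivlMr// mul1r; lra.
Qed.

End SmallParticles.

(** * Weighted integrals of elements of X_0 *)

Lemma measurable_pos (R : realType) : measurable (pos : set R).
Proof. exact: measurable_itv. Qed.
#[local] Hint Extern 0 (measurable pos) => solve [apply: measurable_pos] : core.

Section Weights.
Context (R : realType).
Notation mu := (@lebesgue_measure R).

Lemma X0P (h : R -> R) : X 0 h <-> mu.-integrable pos (EFin \o h).
Proof.
rewrite /X (_ : (fun x => _) = EFin \o h)//.
by apply/funext => x; rewrite powRr0 mul1r.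
Qed.

Lemma X0_dual_weight (psi : R -> R) (C : R) : measurable_fun pos psi ->
  (forall x, pos x -> `|psi x| <= C) ->
  X0_dual (fun h => \int[mu]_(x in pos) (psi x * h x)).
Proof.
move=> mpsi psiC.
have intM h : X 0 h -> mu.-integrable pos (EFin \o (psi \* h)).
  by move=> /X0P inth; apply: integrable_bounded_mul => //; exists C.
split.
  move=> a h1 h2 X1 X2; rewrite -RintegralZl//; last exact: intM.
  have intaM : mu.-integrable pos (EFin \o (fun x => a * (psi \* h1) x)).
    by apply: integrable_scale => //; exact: intM.
  rewrite -RintegralD//; last exact: intM.
  by apply: eq_Rintegral => x _; ring.
exists `|C| => h Xh; have /X0P inth := Xh.
rewrite EFin_normr_Rintegral//; last exact: intM.
have mh : measurable_fun pos h.
  by apply/measurable_EFinP; exact: measurable_int inth.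
have mXnorm : measurable_fun pos (fun x => x `^ 0 * `|h x|).
  apply: measurable_funM; last exact: measurableT_comp.
  by apply: measurable_funS (measurable_powR 0).
apply: (le_trans (le_abse_integral _ _ _)) => //.
  exact: measurable_int (intM _ Xh).
rewrite /Xnorm -ge0_integralZl//; last 2 first.
- by apply/measurable_EFinP.
- by move=> x _; rewrite lee_fin mulr_ge0 ?powR_ge0.
apply: ge0_le_integral => //.
- apply: measurableT_comp => //; exact: measurable_int (intM _ Xh).
- by apply/measurable_EFinP; apply: measurable_funM.
- move=> x px; rewrite powRr0 mul1r lee_fin normrM ler_wpM2r//.
  by rewrite (le_trans (psiC _ px))// ler_norm.
Qed.

Lemma within_continuous_gt (A : set R) (g : R -> R) (a c : R) : A a ->
  {within A, continuous g} -> c < g a ->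
  exists2 e, 0 < e & forall s, A s -> `|s - a| < e -> c < g s.
Proof.
move=> Aa /(_ a) /cvgr_gt /[apply].
move=> near_gt; have : nbhs_subspace (a : subspace A) [set s | c < g s].
  exact: near_gt.
rewrite -nbhs_subspace_in// => /nbhs_ballP[e /= e0 be].
exists e => // s As sa; apply: be => //.
by rewrite /ball/= distrC.
Qed.

(** If the integral vanished, [h] would vanish almost everywhere on (0,oo), and
    its mass with it. *)
Lemma Rintegral_weight_gt0 (psi h : R -> R) : measurable_fun pos psi ->
  (forall x, pos x -> 0 < psi x <= 1) ->
  X 0 h -> ae_nonneg h -> (0 < M 1 h)%E ->
  0 < \int[mu]_(x in pos) (psi x * h x).
Proof.
move=> mpsi psi0 /X0P inth h0 Mh; rewrite ltNge; apply/negP => I0.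
have intp : mu.-integrable pos (EFin \o (psi \* h)).
  apply: integrable_bounded_mul => //; exists 1 => x /psi0/andP[p0 p1].
  by rewrite gtr0_norm.
have mh : measurable_fun pos h.
  by apply/measurable_EFinP; exact: measurable_int inth.
have aeabs : \int[mu]_(x in pos) `|psi x * h x| =
    \int[mu]_(x in pos) (psi x * h x).
  congr fine; apply: ae_eq_integral => //.
  - by apply/measurable_EFinP/measurableT_comp => //; exact: measurable_funM.
  - exact: measurable_int intp.
  - apply: filterS h0 => x /= hx px; rewrite ger0_norm// mulr_ge0//.
      by have /andP[/ltW] := psi0 _ px.
    by rewrite hx// inE.
have : (\int[mu]_(x in pos) `|(psi x * h x)%:E| = 0)%E.
  rewrite -[LHS]fineK; last first.
    by apply: integrable_fin_num => //; exact: integrable_abse intp.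
  congr EFin; apply/eqP; rewrite eq_le; apply/andP; split.
    by rewrite [leLHS]aeabs.
  by rewrite fine_ge0// integral_ge0.
move/(ae_eq_integral_abs _ _ (measurable_int _ intp)) => ae0.
move: Mh; rewrite /M (ae_eq_integral (cst 0%E))//.
- by rewrite integral0 ltxx.
- apply/measurable_EFinP/measurable_funM => //.
  by apply: measurable_funS (measurable_powR 1).
- apply: filterS (ae0 _) => // x /= hx px; have [/eqP] := hx px.
  by rewrite mulf_eq0 gt_eqF ?(andP (psi0 _ px)).1//= => /eqP ->; rewrite mulr0.
Qed.

(** A lower bound for the collision kernel in product form decouples the two
    colliding particles. *)
Lemma collision_integral_ge (k psi h : R -> R) (G : R -> R -> R) :
  measurable_fun pos k -> (exists C : R, forall x, pos x -> `|k x| <= C) ->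
  measurable_fun pos psi -> (exists C : R, forall x, pos x -> `|psi x| <= C) ->
  (forall x y, pos x -> pos y -> k x * psi y <= G x y) ->
  X 0 h -> ae_nonneg h ->
  (mu \x mu)%E.-integrable (pos `*` pos)
    (fun z => (G z.1 z.2 * h z.1 * h z.2)%:E) ->
  \int[mu]_(x in pos) (k x * h x) * \int[mu]_(y in pos) (psi y * h y) <=
  \int[mu]_(x in pos) \int[mu]_(y in pos) (G x y * h x * h y).
Proof.
move=> mk bk mpsi bpsi kG /X0P inth h0 intG.
have intk : mu.-integrable pos (EFin \o (k \* h)).
  exact: integrable_bounded_mul.
have intpsi : mu.-integrable pos (EFin \o (psi \* h)).
  exact: integrable_bounded_mul.
rewrite -RintegralZr//.
apply: ae_le_Rintegral => //.
- under [EFin \o _]eq_fun do rewrite /= mulrC.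
  exact: integrable_scale.
- exact: (@integrable_Rintegral1 _ _ _ _ _ mu mu _ _
    (fun z => G z.1 z.2 * h z.1 * h z.2)).
have := @integrable_section1 _ _ _ _ _ mu mu _ _
    (fun z => G z.1 z.2 * h z.1 * h z.2)
    (@measurable_pos R) (@measurable_pos R) intG.
move: (h0); apply: filterS2 => x hx intGx px /=.
rewrite -RintegralZl//; apply: ae_le_Rintegral => //.
- exact: integrable_scale.
- exact: intGx.
apply: filterS h0 => y hy py.
have -> : k x * h x * (psi y * h y) = k x * psi y * h x * h y by ring.
by rewrite !ler_wpM2r ?kG//; [apply: hy|apply: hx]; rewrite inE.
Qed.

End Weights.

(** * Superpolynomial growth from a linear differential inequality *)

Section Growth.
Context (R : realType).
Notation mu := (@lebesgue_measure R).

Lemma Rintegral_ge_step (Phi : R -> R) (t a h c : R) :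
  mu.-integrable `]0, t[ (EFin \o Phi) ->
  {ae mu, forall s, `]0, t[%classic s -> 0 <= Phi s} ->
  0 <= a -> 0 < h -> a + h <= t ->
  {ae mu, forall s, `]0, t[%classic s -> a < s -> c <= Phi s} ->
  c * h <= \int[mu]_(s in `]0, t[) Phi s.
Proof.
move=> intPhi Phi0 a0 h0 aht Phic.
have int1 : mu.-integrable `]0, t[ (EFin \o (\1_(`]a, (a + h)[ : set R))).
  apply: (@integrableS _ _ _ _ setT) => //.
  exact: integrable_indic_itv.
have muE : mu (`]a, (a + h)[%classic : set R) = h%:E.
  by rewrite lebesgue_measure_itv/= lte_fin ltrDl h0 -EFinB addrAC subrr add0r.
have <- : \int[mu]_(s in `]0, t[) (c * \1_(`]a, (a + h)[ : set R) s) = c * h.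
  rewrite RintegralZl//; congr (_ * _); rewrite /Rintegral integral_indic//.
  rewrite setIidl; last first.
    by apply: subset_itv; rewrite bnd_simp.
  exact: (congr1 fine muE).
apply: ae_le_Rintegral => //; first exact: integrable_scale.
move: Phi0 Phic; apply: filterS2 => s Phi0 Phic st.
rewrite indicE mem_setE in_itv/=.
case: (boolP (a < s < a + h)) => [/andP[as_ _]|_].
  by rewrite mulr1 Phic.
by rewrite mulr0 Phi0.
Qed.

(** A discrete Gronwall inequality, in reverse, for N' = Phi / 2 with Phi >= p and
    Phi >= r N: over [n.+1] equal steps, the first one produces the amount h p / 2
    and each of the others multiplies the lower bound by h r / 2, where h is the
    length of a step. The number of steps fixes the power of [r], which is all
    that matters when [r] is large. *)
Lemma iterated_growth (N Phi : R -> R) (eta p r N0 : R) (n : nat) :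
  0 < eta -> 0 <= p -> 0 <= r -> 0 <= N0 ->
  mu.-integrable `]0, eta[ (EFin \o Phi) ->
  (forall t, 0 <= t <= eta ->
     N t = N0 + 2^-1 * \int[mu]_(s in `]0, t[) Phi s) ->
  {ae mu, forall s, `]0, eta[%classic s -> p <= Phi s} ->
  {ae mu, forall s, `]0, eta[%classic s -> r * N s <= Phi s} ->
  (eta / n.+1%:R / 2) ^+ n.+1 * r ^+ n * p <= N eta.
Proof.
move=> eta0 p0 r0 N00 intPhi NE Phip PhiN.
pose h := eta / n.+1%:R.
have h0 : 0 < h by rewrite divr_gt0.
have step (c a t : R) : 0 <= a -> a + h <= t -> t <= eta ->
    {ae mu, forall s, `]0, eta[%classic s -> a < s -> c <= Phi s} ->
    h / 2 * c <= N t.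
  move=> a0 aht teta Phic.
  have sub : `]0, t[%classic `<=` (`]0, eta[%classic : set R).
    by apply: subset_itvl; rewrite bnd_simp.
  rewrite NE; last by rewrite teta andbT (le_trans _ aht)// addr_ge0// ltW.
  rewrite (@le_trans _ _ (2^-1 * (c * h)))//; first by lra.
  rewrite ler_wpDl// ler_wpM2l ?invr_ge0//.
  apply: (@Rintegral_ge_step _ _ a) => //.
  - by apply: integrableS intPhi.
  - by apply: filterS Phip => s ps /sub/ps; exact: le_trans.
  - by apply: filterS Phic => s cs /sub/cs.
have key j : (j <= n)%N -> forall t, j.+1%:R * h <= t -> t <= eta ->
    (h / 2) ^+ j.+1 * r ^+ j * p <= N t.
  elim: j => [_|j IH jn] t jt teta.
    rewrite expr1 expr0 mulr1; apply: (step p 0 t) => //.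
      by rewrite add0r -(mul1r h).
    by apply: filterS Phip => s ps /ps.
  rewrite exprS [r ^+ _]exprS.
  set c := (h / 2) ^+ j.+1 * r ^+ j * p.
  rewrite (_ : _ * _ * _ = h / 2 * (r * c)); last by rewrite /c; ring.
  apply: (step _ (j.+1%:R * h)) => //.
  - by rewrite mulr_ge0// ltW.
  - by rewrite -[X in _ + X]mul1r -mulrDl natr1.
  apply: filterS PhiN => s Ns seta js; apply: (le_trans _ (Ns seta)).
  rewrite ler_wpM2l// IH//; [exact: ltnW|exact: ltW|].
  by move: seta; rewrite /= in_itv/= => /andP[_ /ltW].
by apply: (key n) => //; rewrite /h mulrCA divff// mulr1.
Qed.

End Growth.

(** * Growth of the number of small particles *)

Section SmallParticleNumber.
Context (R : realType).
Notation mu := (@lebesgue_measure R).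
Context (alpha beta nu : R).
Context (nu1 : -1 < nu) (nu0 : nu <= 0) (alpha0 : alpha <= 0).

(** A bounded weight, positive on (0,oo), that lies below y^beta (for the second
    particle in the term x^alpha y^beta of the kernel) and below the product of
    x^alpha with the profile of [excess_ge_power] (for the first one). Being
    bounded, it defines a weakly continuous functional on X_0. *)
Definition weight (x : R) : R :=
  Num.min 1 (Num.min (x `^ beta) (Num.min 1 (x `^ (- nu - 1)) * x `^ alpha)).

Lemma measurable_weight : measurable_fun setT weight.
Proof.
have mp := @measurable_powR R.
rewrite /weight; apply: measurable_minr => //; apply: measurable_minr => //.
by apply: measurable_funM => //; apply: measurable_minr.
Qed.

Lemma weight_bound (x : R) : pos x -> 0 < weight x <= 1.
Proof.
rewrite /pos/= in_itv/= andbT => x0.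
rewrite /weight ge_min lexx andbT !lt_min !ltr01 mulr_gt0 ?powR_gt0//.
by rewrite lt_min ltr01 powR_gt0.
Qed.

Definition rate (e x y : R) : R :=
  (excess nu e x + excess nu e y) * K_ab alpha beta x y.

Lemma rate_ge (e x y c : R) : 0 < e -> 0 < x -> 0 < y ->
  c <= excess nu e x * x `^ alpha -> c * weight y <= rate e x y.
Proof.
move=> e0 x0 y0 cx; rewrite /rate mulrDl.
have ex0 (w : R) : 0 < w -> 0 <= excess nu e w by move=> w0; exact: excess_ge0.
have pow0 (w p : R) : 0 <= w `^ p by exact: powR_ge0.
apply: (@le_trans _ _ (excess nu e x * x `^ alpha * y `^ beta)).
  apply: (@le_trans _ _ (excess nu e x * x `^ alpha * weight y)).
    have /andP[/ltW wy0 _] : 0 < weight y <= 1.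
      by apply: weight_bound; rewrite /pos/= in_itv/= y0.
    by rewrite ler_wpM2r.
  by rewrite ler_wpM2l ?mulr_ge0 ?ex0// /weight !ge_min lexx orbT.
rewrite -mulrA /K_ab -[leLHS]addr0 mulrDr -addrA lerD2l.
by apply: addr_ge0; apply: mulr_ge0; rewrite ?ex0 ?addr_ge0 ?mulr_ge0.
Qed.

(** Below the size [e] the power x^alpha is at least e^alpha: this is where the
    sign of [alpha] makes small particles dangerous. *)
Lemma rate_ge_indic (e x y : R) : 0 < e -> 0 < x -> 0 < y ->
  (e `^ alpha * \1_(`]0, e[ : set R) x) * weight y <= rate e x y.
Proof.
move=> e0 x0 y0; apply: rate_ge => //.
rewrite mulrC; have [xe|ex] := ltP x e.
  apply: ler_pM; rewrite ?powR_ge0 ?excess_ge_indic//.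
  rewrite -(opprK alpha) 2!(powRN _ (- alpha)) lef_pV2 ?posrE ?powR_gt0//.
  by rewrite ge0_ler_powR ?nnegrE ?oppr_ge0// ltW.
rewrite indicE memNset ?mul0r ?mulr_ge0 ?powR_ge0 ?excess_ge0//=.
by rewrite in_itv/= x0/= ltNge ex.
Qed.

Lemma rate_ge_weight (e x y : R) : 0 < e -> e <= 1 -> 0 < x -> 0 < y ->
  (e `^ (nu + 1) * weight x) * weight y <= rate e x y.
Proof.
move=> e0 e1 x0 y0; apply: rate_ge => //.
apply: (@le_trans _ _
  (e `^ (nu + 1) * Num.min 1 (x `^ (- nu - 1)) * x `^ alpha)).
  by rewrite -mulrA ler_wpM2l ?powR_ge0// /weight !ge_min lexx !orbT.
by rewrite ler_wpM2r ?powR_ge0// excess_ge_power.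
Qed.

(** The two lower bounds on [rate], integrated against f(s,x) f(s,y), are the two
    differential inequalities required by [iterated_growth]. *)
Lemma small_number_growth (fin : R -> R) (T : \bar R) (f : R -> R -> R)
    (eta delta e : R) (n : nat) :
  X 0 fin -> ae_nonneg fin ->
  weak_solution (K_ab alpha beta) (b_nu nu) fin T f ->
  0 < eta -> (eta%:E < T)%E -> 0 <= delta ->
  (forall s : R, 0 <= s <= eta ->
     delta <= \int[mu]_(x in pos) (weight x * f s x)) ->
  0 < e -> e <= 1 ->
  (eta / n.+1%:R / 2) ^+ n.+1 * (e `^ alpha * delta) ^+ n *
    (e `^ (nu + 1) * delta ^+ 2) <=
  \int[mu]_(x in pos) (\1_(`]0, e[ : set R) x * f eta x).
Proof.
move=> Xfin fin0 [f0 [Xf _] _ Kf wf] eta0 etaT delta0 Pdelta e0 e1.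
have mpos := @measurable_pos R.
have tT (t : R) : 0 <= t <= eta -> ico0 T t.
  move=> /andP[t0 teta]; split => //.
  by apply: le_lt_trans etaT; rewrite lee_fin.
have mI : measurable_fun setT (\1_(`]0, e[ : set R) : R -> R).
  exact: measurable_indic.
have bI (x : R) : `|\1_(`]0, e[ : set R) x| <= 1.
  by rewrite indicE normr_nat lern1 leq_b1.
have intI h : X 0 h -> mu.-integrable pos (EFin \o (\1_(`]0, e[ : set R) \* h)).
  by move=> /X0P inth; apply: integrable_bounded_mul => //; exists 1.
pose N t := \int[mu]_(x in pos) (\1_(`]0, e[ : set R) x * f t x).
pose Phi s := \int[mu]_(x in pos) \int[mu]_(y in pos)
  (rate e x y * f s x * f s y).
have posE (x : R) : x \in pos -> 0 < x by rewrite inE /pos/= in_itv/= andbT.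
have posP (x : R) : pos x -> 0 < x by rewrite /pos/= in_itv/= andbT.
have intF : (mu \x (mu \x mu))%E.-integrable (`]0, eta[ `*` (pos `*` pos))
    (EFin \o (fun p => rate e p.2.1 p.2.2 * f p.1 p.2.1 * f p.1 p.2.2)).
  have mD : measurable
      (`]0, eta[%classic `*` (pos `*` pos) : set (R * (R * R))).
    by apply: measurableX => //; exact: measurableX.
  have etaT' : ioo0 T eta by [].
  have := Kf _ etaT'.
  pose k (p : R * (R * R)) : R := excess nu e p.2.1 + excess nu e p.2.2.
  pose g (p : R * (R * R)) : R :=
    K_ab alpha beta p.2.1 p.2.2 * f p.1 p.2.1 * f p.1 p.2.2.
  move=> intg.
  rewrite (_ : (fun p => _) = k \* g); last first.
    by apply/funext => p; rewrite /k /g /rate /=; ring.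
  apply: (@integrable_bounded_mul _ _ _ (mu \x (product_sf mu mu))%E
    _ k g mD) => //.
    apply: (@measurable_funS _ _ _ _ setT) => //.
    apply: measurable_funD; apply: (measurableT_comp (measurable_excess nu e));
      by do 2 apply: measurableT_comp => //.
  exists ((nu + 2) / (nu + 1) + (nu + 2) / (nu + 1)).
  move=> -[s [x y]] [_ [/= px py]].
  have [x0 y0] := (posP _ px, posP _ py); rewrite /k /=.
  rewrite ger0_norm; first by apply: lerD; exact: excess_le.
  by apply: addr_ge0; exact: excess_ge0.
have intPhi : mu.-integrable `]0, eta[ (EFin \o Phi).
  exact: (@integrable_iterated _ _ _ _ _ _ _ mu mu mu _ _ _
    (fun p => rate e p.2.1 p.2.2 * f p.1 p.2.1 * f p.1 p.2.2)).
have aeF := @integrable_section1 _ _ _ _ _ mu (product_sf mu mu) _ _ _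
   (measurable_itv _) (measurableX mpos mpos) intF.
have lower (k : R -> R) : measurable_fun setT k ->
    (exists C : R, forall x, pos x -> `|k x| <= C) ->
    (forall x y, pos x -> pos y -> k x * weight y <= rate e x y) ->
    {ae mu, forall s, `]0, eta[%classic s ->
      \int[mu]_(x in pos) (k x * f s x) *
      \int[mu]_(y in pos) (weight y * f s y) <= Phi s}.
  move=> mk bk kr; apply: filterS aeF => s intFs seta.
  have sT : ico0 T s.
    by apply: tT; move: seta; rewrite /= in_itv/= => /andP[/ltW -> /ltW ->].
  apply: collision_integral_ge => //.
  - exact: measurable_funTS mk.
  - exact: measurable_funTS measurable_weight.
  - by exists 1 => x /weight_bound/andP[w0 w1]; rewrite gtr0_norm.
  - exact: Xf.
  - exact: f0.
  - exact: intFs.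
have Iweight h : X 0 h -> mu.-integrable pos (EFin \o (weight \* h)).
  move=> /X0P inth; apply: integrable_bounded_mul => //.
    exact: measurable_funTS measurable_weight.
  by exists 1 => x /weight_bound/andP[w0 w1]; rewrite gtr0_norm.
have scaleE c (k h : R -> R) : mu.-integrable pos (EFin \o (k \* h)) ->
    \int[mu]_(x in pos) (c * k x * h x) = c * \int[mu]_(x in pos) (k x * h x).
  move=> intkh; rewrite -(RintegralZl c _ intkh)//.
  by apply: eq_Rintegral => x _; rewrite /= mulrA.
have Ige0 h : X 0 h -> ae_nonneg h ->
    0 <= \int[mu]_(x in pos) (\1_(`]0, e[ : set R) x * h x).
  move=> Xh h0; apply: ae_Rintegral_ge0 => //; first exact: intI.
  apply: filterS h0 => x hx px; rewrite mulr_ge0//.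
  by rewrite hx// inE.
apply: (@iterated_growth _ N Phi eta _ _
  (\int[mu]_(x in pos) (\1_(`]0, e[ : set R) x * fin x))) => //.
- by rewrite mulr_ge0 ?powR_ge0 ?exprn_ge0.
- by rewrite mulr_ge0 ?powR_ge0.
- exact: Ige0.
- move=> t /tT tT'.
  have LI : Linfty (\1_(`]0, e[ : set R)).
    split; first exact: measurable_funTS mI.
    by exists 1; apply: aeW => x _.
  have PhiE : \int[mu]_(s in `]0, t[) Phi s =
      \int[mu]_(s in `]0, t[) \int[mu]_(x in pos) \int[mu]_(y in pos)
        (zeta (b_nu nu) (\1_(`]0, e[ : set R)) x y * K_ab alpha beta x y *
         f s x * f s y).
    apply: eq_Rintegral => s _; apply: eq_Rintegral => x /posE x0.
    by apply: eq_Rintegral => y /posE y0; rewrite zeta_indic.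
  have NE : \int[mu]_(x in pos) (\1_(`]0, e[ : set R) x * (f t x - fin x)) =
      N t - \int[mu]_(x in pos) (\1_(`]0, e[ : set R) x * fin x).
    under eq_Rintegral do rewrite mulrBr.
    apply: (@RintegralB _ _ _ mu pos (\1_(`]0, e[ : set R) \* f t)
      (\1_(`]0, e[ : set R) \* fin)).
    - exact: measurable_pos.
    - exact: intI (Xf _ tT').
    - exact: intI.
  by rewrite PhiE -(wf t _ tT' LI) NE addrC subrK.
- have := lower (fun x => e `^ (nu + 1) * weight x).
  move=> /(_ _ _ _)/filterS; apply.
  + move=> s H seta; apply: le_trans (H seta).
    have /andP[s0 s1] : 0 < s < eta by move: seta; rewrite /= in_itv.
    have sT : ico0 T s by apply: tT; rewrite !ltW.
    have ds : delta <= \int[mu]_(x in pos) (weight x * f s x).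
      by apply: Pdelta; rewrite !ltW.
    rewrite (scaleE _ _ _ (Iweight _ (Xf _ sT))).
    by rewrite -mulrA ler_wpM2l ?powR_ge0// expr2 ler_pM.
  + by apply: measurable_funM => //; exact: measurable_weight.
  + exists (e `^ (nu + 1)) => x /weight_bound/andP[w0 w1].
    rewrite normrM (ger0_norm (powR_ge0 _ _)) (gtr0_norm w0).
    by rewrite ler_piMr ?powR_ge0.
  + by move=> x y /posP x0 /posP y0; exact: rate_ge_weight.
- have := lower (fun x => e `^ alpha * \1_(`]0, e[ : set R) x).
  move=> /(_ _ _ _)/filterS; apply.
  + move=> s H seta; apply: le_trans (H seta).
    have /andP[s0 s1] : 0 < s < eta by move: seta; rewrite /= in_itv.
    have sT : ico0 T s by apply: tT; rewrite !ltW.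
    have ds : delta <= \int[mu]_(x in pos) (weight x * f s x).
      by apply: Pdelta; rewrite !ltW.
    rewrite (scaleE _ _ _ (intI _ (Xf _ sT))) mulrAC.
    rewrite ler_wpM2l// mulr_ge0 ?powR_ge0//.
    by apply: Ige0; [exact: Xf|exact: f0].
  + exact: measurable_funM.
  + exists (e `^ alpha) => x _.
    by rewrite normrM (ger0_norm (powR_ge0 _ _)) ler_piMr ?powR_ge0 ?bI.
  + by move=> x y /posP x0 /posP y0; exact: rate_ge_indic.
Qed.

End SmallParticleNumber.

(** * Non-existence *)

Lemma powR_product_unbounded (R : realType) (alpha nu : R) (n : nat) (C B : R) :
  0 < C -> 0 <= B -> nu + 1 + alpha * n%:R <= -1 ->
  exists e : R,
    [/\ 0 < e, e <= 1 & B < C * ((e `^ alpha) ^+ n * e `^ (nu + 1))].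
Proof.
move=> C0 B0 expo.
pose e := C / (B + C + 1).
have BC0 : 0 < B + C + 1 by lra.
have e0 : 0 < e by rewrite divr_gt0.
have e1 : e <= 1 by rewrite ler_pdivrMr// mul1r; lra.
(* as e <= 1, the product of powers is at least 1/e, and C/e = B + C + 1 *)
exists e; split => //.
rewrite -powR_mulrn ?powR_ge0// -powRrM -powRD ?(gt_eqF e0) ?implybT//.
apply: (@lt_le_trans _ _ (C * e `^ (-1))).
  by rewrite powR_inv1 ?(ltW e0)// invf_div mulrCA divff ?gt_eqF// mulr1; lra.
by rewrite ler_pM2l// ger_powR ?e0// addrC.
Qed.

Theorem theorem1p8 (R : realType) (alpha beta nu m0 : R) (fin : R -> R)
  (hab : alpha <= beta) (hb : beta <= 1)
  (hnu1 : -1 < nu) (hnu0 : nu <= 0)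
  (hfin0 : X 0 fin) (hfin1 : Xplus 1 fin) (hM1 : (0 < M 1 fin)%E)
  (hm0 : 1 < m0) (hfinm0 : X m0 fin)
  (ha : alpha < 0) :
  forall T : \bar R, (0 < T)%E ->
    ~ exists f : R -> R -> R,
        mass_conserving_weak_solution (K_ab alpha beta) (b_nu nu) fin T f.
Proof.
move=> T T0 [f [wf massf]].
have [f0 [Xf Cf] _ _ _] := wf.
have zT : ico0 T 0 by split.
pose P s :=
  \int[@lebesgue_measure R]_(x in pos) (weight alpha beta nu x * f s x).
have P0 : 0 < P 0.
  apply: Rintegral_weight_gt0; [|exact: weight_bound|exact: Xf|exact: f0|].
    by apply: measurable_funTS; exact: measurable_weight.
  by rewrite massf.
have contP : {within ico0 T, continuous P}.
  apply: (Cf (fun h => \int[@lebesgue_measure R]_(x in pos)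
                       (weight alpha beta nu x * h x))).
  apply: (@X0_dual_weight _ _ 1).
    by apply: measurable_funTS; exact: measurable_weight.
  by move=> x /weight_bound - /(_ alpha beta nu)/andP[w0 w1]; rewrite gtr0_norm.
have [|r r0 Pr] := within_continuous_gt (c := P 0 / 2) zT contP; first lra.
have [eta [eta0 etar etaT]] :
    exists eta : R, [/\ 0 < eta, eta < r & (eta%:E < T)%E].
  case: T T0 {wf massf Xf Cf zT contP Pr f0} => [t|_|//]; last first.
    by exists (r / 2); split; [lra|lra|rewrite ltry].
  rewrite lte_fin => t0; exists (Num.min r t / 2).
  have m0' : 0 < Num.min r t by rewrite lt_min r0.
  have mr : Num.min r t <= r by rewrite ge_min lexx.
  have mt : Num.min r t <= t by rewrite ge_min lexx orbT.
  by split; [lra|lra|rewrite lte_fin; lra].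
have etaico : ico0 T eta by split; [exact: ltW|].
(* n (- alpha) > 2 absorbs nu + 1 <= 1 and leaves an exponent below -1 *)
pose n := (Num.truncn (2 / (- alpha))).+1.
have expo : nu + 1 + alpha * n%:R <= -1.
  have : 2 / (- alpha) < n%:R by exact: truncnS_gt.
  rewrite ltr_pdivrMr ?oppr_gt0// => ?; lra.
pose C := (eta / n.+1%:R / 2) ^+ n.+1 * (P 0 / 2) ^+ n * (P 0 / 2) ^+ 2.
have C0 : 0 < C.
  have d0 : 0 < P 0 / 2 by lra.
  by apply: mulr_gt0; [apply: mulr_gt0|]; rewrite exprn_gt0// !divr_gt0.
pose B := \int[@lebesgue_measure R]_(x in pos) `|f eta x|.
have B0 : 0 <= B by exact: Rintegral_ge0.
have [e [e0 e1 /lt_geF/negP]] := powR_product_unbounded C0 B0 expo; apply.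
have := @small_number_growth _ _ beta _ hnu1 hnu0 (ltW ha) _ _ _ eta (P 0 / 2)
  e n hfin0 hfin1.2 wf eta0 etaT.
move=> /(_ _ _ e0 e1) H.
apply: (@le_trans _ _ (\int[@lebesgue_measure R]_(x in pos)
    (\1_(`]0, e[ : set R) x * f eta x))).
  have -> : C * ((e `^ alpha) ^+ n * e `^ (nu + 1)) =
    (eta / n.+1%:R / 2) ^+ n.+1 * (e `^ alpha * (P 0 / 2)) ^+ n *
      (e `^ (nu + 1) * (P 0 / 2) ^+ 2).
    by rewrite /C [(e `^ alpha * _) ^+ _]exprMn; ring.
  apply: H; first lra.
  move=> s /andP[s0 seta]; apply/ltW/Pr.
    by split => //; apply: le_lt_trans etaT; rewrite lee_fin.
  by rewrite subr0 ger0_norm// (le_lt_trans seta).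
have /X0P intf := Xf _ etaico.
apply: ae_le_Rintegral => //.
- apply: integrable_bounded_mul => //; exists 1 => x _.
  by rewrite indicE normr_nat lern1 leq_b1.
- exact: integrable_norm.
apply: aeW => x _; apply: le_trans (ler_norm _) _; rewrite normrM.
by rewrite ler_piMl// indicE normr_nat lern1 leq_b1.
Qed.
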